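(* Let $$\kappa=\min\Big\{\frac{S^{\text{min}}}{E^{\text{max}}},\ \frac{S^{\text{max}}-S^{\text{min}}}{E^{\text{max}}}\Big\}.$$ If $(S_2,E_2)\in\mathcal{O}$, then $S_2-\kappa E_2\ge 0$.
   Context: Superscripts are labels, not powers. $\mathcal{O}\subset\mathbb{R}^2$ (the set of feasible operating points $(S,E)$, where $S$ is satisfaction and $E$ is energy usage) is a compact, possibly nonconvex, polygonal region. $S^{\text{min}},S^{\text{max}}$ and $E^{\text{min}},E^{\text{max}}$ are the minimum and maximum of the $S$- and $E$-coordinates over $\mathcal{O}$. In the model $E^{\text{max}}>0$ and $\kappa>0$. *)

(* Defs.v *)
From mathcomp Require Import all_boot all_order all_algebra.
From mathcomp Require Import all_classical all_reals all_analysis.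
Import Order.TTheory GRing.Theory Num.Theory.
Import numFieldNormedType.Exports.

Set Implicit Arguments.
Unset Strict Implicit.
Unset Printing Implicit Defensive.

Local Open Scope classical_set_scope.
Local Open Scope ring_scope.

(* [R^o] rather than [R], so that the plane is an [lmodType R]. *)
Notation plane R := (R^o * R^o)%type.

Definition convex_hull (R : realType) (A : set (plane R)) : set (plane R) :=
  smallest (@convex_set R (plane R)) A.

(* A finite union of convex polygons, each given by its finite list of
   vertices. The region need not be convex or connected, may have holes, and
   may have degenerate pieces (segments, points). *)
Definition polygonal (R : realType) (A : set (plane R)) : Prop :=
  exists P : seq (seq (plane R)),
    A = \bigcup_(s in [set` P]) convex_hull [set` s].

Definition is_minimum (R : realType) (A : set R) (m : R) : Prop :=
  A m /\ lbound A m.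

Definition is_maximum (R : realType) (A : set R) (m : R) : Prop :=
  A m /\ ubound A m.

Definition kappa (R : realType) (Smin Smax Emax : R) : R :=
  Num.min (Smin / Emax) ((Smax - Smin) / Emax).

(* Main.v *)
Require Import Defs.
From mathcomp Require Import all_boot all_order all_algebra.
From mathcomp Require Import all_classical all_reals all_analysis.
Import Order.TTheory GRing.Theory Num.Theory.
Import numFieldNormedType.Exports.

Local Open Scope classical_set_scope.
Local Open Scope ring_scope.

(** The bound follows from the chain [kappa * E2 <= kappa * Emax <= Smin <= S2], whose outer links
    come from the extremality of [Emax] and [Smin] over [O]. *)

Theorem proposition7 (R : realType) (O : set (plane R))
  (O_compact : compact O) (O_polygonal : polygonal O)
  (Smin Smax Emin Emax : R)
  (SminP : is_minimum [set p.1 | p in O] Smin)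
  (SmaxP : is_maximum [set p.1 | p in O] Smax)
  (EminP : is_minimum [set p.2 | p in O] Emin)
  (EmaxP : is_maximum [set p.2 | p in O] Emax)
  (Emax_gt0 : 0 < Emax)
  (kappa_gt0 : 0 < kappa Smin Smax Emax)
  (S2 E2 : R) (O2 : O (S2, E2)) :
  0 <= S2 - kappa Smin Smax Emax * E2.
Proof.
have E2_le : E2 <= Emax by apply: EmaxP.2; exists (S2, E2).
have S2_ge : Smin <= S2 by apply: SminP.2; exists (S2, E2).
rewrite subr_ge0; apply: le_trans S2_ge.
apply: (@le_trans _ _ (kappa Smin Smax Emax * Emax)).
  (* Positivity of [kappa] preserves [E2 <= Emax], whatever the sign of [E2]. *)
  by rewrite ler_pM2l.
(* Dividing by [Emax > 0] leaves [kappa <= Smin / Emax], the first argument of the minimum. *)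
by rewrite -ler_pdivlMr // /kappa ge_min lexx.
Qed.
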